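(* Let $\mathfrak{G}$ be a presheaf of finite $p$-groups on $\mathscr{V}_f$ with $\mathfrak{G}(0)=\{e\}$. Then $\mathfrak{G}$ is $p$-finite if and only if its underlying presheaf of sets is finite.
   Context: $p$ prime, $\mathbb{F}=\mathbb{F}_p$, $\mathscr{V}_f$ the category of finite-dimensional $\mathbb{F}$-vector spaces. $\mathscr{F}$ is the abelian category of functors $\mathscr{V}_f^{\mathrm{op}}\to$ ($\mathbb{F}$-vector spaces); such a functor is finite if it has a finite composition series. A presheaf of sets $X$ on $\mathscr{V}_f$ is finite if there is a monomorphism $X\hookrightarrow F_X$ of presheaves of sets with $F_X\in\mathscr{F}$ finite (viewed as a presheaf of sets). For a finite $p$-group $G$, $\Phi G=[G,G]G^p$, $\Phi_0G=G$, $\Phi_{n+1}G=\Phi(\Phi_nG)$; for a presheaf of finite $p$-groups $\mathfrak{G}$, $\Phi_n\mathfrak{G}(V)=\Phi_n(\mathfrak{G}(V))$. $\mathfrak{G}$ is $p$-finite if $\bigoplus_{n\ge0}\Phi_n\mathfrak{G}/\Phi_{n+1}\mathfrak{G}$ is a finite functor of $\mathscr{F}$. *)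

(* Defs.v *)
From mathcomp Require Import all_boot all_order all_algebra all_fingroup all_solvable.
Set Implicit Arguments. Unset Strict Implicit. Unset Printing Implicit Defensive.
Import GRing.Theory.
Local Open Scope ring_scope.

(* Conventions.
   The category V_f is replaced by its skeleton: objects are n : nat (standing
   for F^n, F = 'F_p), and a morphism F^n -> F^m is a matrix A : 'M['F_p]_(n,m)
   acting on row vectors (v |-> v *m A).  Composition "A then B" is A *m B.
   A presheaf (contravariant functor) X sends A : 'M_(n,m) to X m -> X n. *)

Section Defs.
Variable p : nat.

Definition is_Ffunctor (V : nat -> lmodType 'F_p)
    (f : forall m n, 'M['F_p]_(n, m) -> V m -> V n) : Prop :=
  [/\ (forall m n A (a : 'F_p) (x y : V m),
          f m n A (a *: x + y) = a *: f m n A x + f m n A y),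
      (forall n (x : V n), f n n 1%:M x = x) &
      (forall l m n (A : 'M['F_p]_(n, m)) (B : 'M['F_p]_(m, l)) (x : V l),
          f l n (A *m B) x = f m n A (f l m B x))].

Definition subfunctor (V : nat -> lmodType 'F_p)
    (f : forall m n, 'M['F_p]_(n, m) -> V m -> V n)
    (S : forall n, V n -> Prop) : Prop :=
  [/\ (forall n, S n 0),
      (forall n x y, S n x -> S n y -> S n (x + y)),
      (forall n (a : 'F_p) x, S n x -> S n (a *: x)) &
      (forall m n A x, S m x -> S n (f m n A x))].

Definition sub_le (V : nat -> lmodType 'F_p) (S T : forall n, V n -> Prop) :=
  forall n x, S n x -> T n x.

(* 0 = S_0 <= S_1 <= ... <= S_k = F with every S_(i+1)/S_i simple, i.e.
   S_i is a proper subfunctor of S_(i+1) and there is no subfunctor strictly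
   in between (subfunctors of S_(i+1)/S_i <-> subfunctors between). *)
Definition composition_series (V : nat -> lmodType 'F_p)
    (f : forall m n, 'M['F_p]_(n, m) -> V m -> V n)
    (k : nat) (S : nat -> forall n, V n -> Prop) : Prop :=
  [/\ (forall i, (i <= k)%N -> subfunctor f (S i)),
      (forall n x, S 0%N n x <-> x = 0),
      (forall n x, S k n x) &
      (forall i, (i < k)%N ->
         [/\ sub_le (S i) (S i.+1),
             ~ sub_le (S i.+1) (S i) &
             forall T, subfunctor f T -> sub_le (S i) T -> sub_le T (S i.+1) ->
               sub_le T (S i) \/ sub_le (S i.+1) T])].

Definition finite_functor (V : nat -> lmodType 'F_p)
    (f : forall m n, 'M['F_p]_(n, m) -> V m -> V n) : Prop :=
  is_Ffunctor f /\ exists k S, composition_series f k S.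

Definition finite_set_presheaf (X : nat -> Type)
    (Xmap : forall m n, 'M['F_p]_(n, m) -> X m -> X n) : Prop :=
  exists (V : nat -> lmodType 'F_p) (f : forall m n, 'M['F_p]_(n, m) -> V m -> V n),
    finite_functor f /\
    exists i : forall n, X n -> V n,
      (forall n, injective (i n)) /\
      (forall m n A x, i n (Xmap m n A x) = f m n A (i m x)).

Record gpresheaf := GPresheaf {
  g_obj : nat -> finGroupType;
  g_map : forall m n, 'M['F_p]_(n, m) -> g_obj m -> g_obj n;
  g_mapM : forall m n (A : 'M['F_p]_(n, m)) (x y : g_obj m),
      g_map A (x * y)%g = (g_map A x * g_map A y)%g;
  g_map1 : forall n (x : g_obj n), g_map (1%:M : 'M['F_p]_n) x = x;
  g_mapC : forall l m n (A : 'M['F_p]_(n, m)) (B : 'M['F_p]_(m, l)) (x : g_obj l),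
      g_map (A *m B) x = g_map A (g_map B x)
}.

Definition PhiP (gT : finGroupType) (H : {set gT}) : {set gT} :=
  <<[set [~ x, y] | x in H, y in H] :|: [set x ^+ p | x in H]>>%g.

Definition PhiN (gT : finGroupType) (k : nat) : {set gT} := iter k (@PhiP gT) [set: gT].

Definition grQ (gT : finGroupType) (k : nat) : {set coset_of (PhiN gT k.+1)} :=
  (PhiN gT k / PhiN gT k.+1)%g.

Definition grdim (gT : finGroupType) (k : nat) : nat := logn p #|grQ gT k|.

Definition is_coord (cT : finGroupType) (Q : {set cT}) d (c : {ffun cT -> 'rV['F_p]_d}) : bool :=
  [&& [forall x in Q, forall y in Q, c (x * y)%g == c x + c y],
      [forall v : 'rV['F_p]_d, exists x in Q, c x == v] &
      [forall x in Q, forall y in Q, (c x == c y) ==> (x == y)]].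

Definition coordf (cT : finGroupType) (Q : {set cT}) : cT -> 'rV['F_p]_(logn p #|Q|) :=
  odflt [ffun=> 0] [pick c | is_coord Q c].

Definition uncoordf (cT : finGroupType) (Q : {set cT}) (v : 'rV['F_p]_(logn p #|Q|)) : cT :=
  odflt 1%g [pick x in Q | coordf Q x == v].

Arguments g_map : clear implicits.
Variable G : gpresheaf.

Definition gr_piece_map m n (A : 'M['F_p]_(n, m)) (k : nat)
    (v : 'rV['F_p]_(grdim (g_obj G m) k)) : 'rV['F_p]_(grdim (g_obj G n) k) :=
  coordf (grQ (g_obj G n) k)
    (coset (PhiN (g_obj G n) k.+1) (g_map G m n A (repr (uncoordf v)))).

(* Phi_k G(n) = 1 for k >= #|G(n)|, so the direct sum over all k >= 0 is the
   (finite) sum over k < #|G(n)|. *)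
Definition grN n : nat := #|g_obj G n|.

Definition gr_obj (n : nat) : lmodType 'F_p :=
  'rV['F_p]_(\sum_(k < grN n) grdim (g_obj G n) k).

Definition gr_map m n (A : 'M['F_p]_(n, m)) (v : gr_obj m) : gr_obj n :=
  \mxrow_(k < grN n)
     match @idP (nat_of_ord k < grN m)%N with
     | ReflectT h => gr_piece_map A (submxrow v (Ordinal h))
     | ReflectF _ => 0
     end.

Definition p_finite : Prop := finite_functor gr_map.

Definition finite_underlying : Prop := finite_set_presheaf (g_map G).

End Defs.

(* Main.v *)
Require Import Defs.
From mathcomp Require Import all_boot all_order all_algebra all_fingroup all_solvable.
From mathcomp Require Import all_character boolp zify.

(** Both conditions are equivalent to polynomial growth of [logn p #|G n|].

    A functor of finite length has polynomial growth: if s generates a simple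
    subquotient, the sufficiently long iterated differences of A |-> A^* s vanish
    at the level of s, because on a finite elementary abelian p-group each
    difference operator has p-th power zero; by simplicity they vanish everywhere,
    so A^* s is a combination of terms B^* s where B has boundedly many nonzero
    rows.

    Conversely, a nonzero element x of X(F^k) that dies on every coordinate
    hyperplane forces at least 2^(q^k) elements in X(F^(kq)), for any presheaf
    X of groups.  Hence polynomial growth of degree D kills the cross effects of
    order k > D: elements are detected on F^D.  For functors this makes every
    subfunctor determined by its value at F^D, which gives finite length.  For G it
    gives an embedding x |-> (a |-> rho (a^* x)), a : F^D -> F^n, with rho the regular
    representation of G(F^D) over F_p.  Since the augmentation ideal of a p-group
    is nilpotent in characteristic p, the linear span of the image at F^n is spanned
    by bounded-length words in few generators of G(F^n), so it is a functor of
    polynomial growth, hence finite.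

    Finally the graded functor of the Phi-filtration has as many elements at F^n as
    G(F^n). *)

Set Implicit Arguments. Unset Strict Implicit. Unset Printing Implicit Defensive.
Import GRing.Theory.
Local Open Scope ring_scope.

(** * Iterated differences *)

Section Deltas.
Variables (E M : zmodType).

Fixpoint deltas (l : seq E) (g : E -> M) (x : E) : M :=
  if l is a :: l' then deltas l' g (x + a) - deltas l' g x else g x.

Lemma deltas_cat s t g x : deltas (s ++ t) g x = deltas s (deltas t g) x.
Proof. by elim: s x => //= a s IH x; rewrite !IH. Qed.

Lemma deltas_swap a b l g x : deltas (a :: b :: l) g x = deltas (b :: a :: l) g x.
Proof.
rewrite /= (addrAC x b a).
by rewrite -!addrA -!opprD addrCA [X in _ = _ + - X]addrCA; congr (_ - _); rewrite opprD.
Qed.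

Lemma deltas_rem a l g x : a \in l -> deltas l g x = deltas (a :: rem a l) g x.
Proof.
elim: l x => // b l IH x; rewrite inE; case: (eqVneq b a) => [-> _|nba /= al].
  by rewrite /= eqxx.
by rewrite ?(negPf nba) !(IH _ al) -/(deltas (b :: a :: rem a l) g x) deltas_swap.
Qed.

Lemma deltas_perm l1 l2 g x : perm_eq l1 l2 -> deltas l1 g x = deltas l2 g x.
Proof.
elim: l1 l2 x => [|a s IH] l2 x; first by rewrite perm_sym => /perm_nilP->.
move=> pe; have al : a \in l2 by rewrite -(perm_mem pe) mem_head.
rewrite (deltas_rem _ _ al) /=.
have pe' : perm_eq s (rem a l2).
  by rewrite -(perm_cons a) (perm_trans pe) // perm_to_rem.
by rewrite !(IH _ _ pe').
Qed.

(** The difference expands to a signed sum of values of [g] at [x] plus the subset sums of [l]; each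
    mask [m] selects a subset. *)
Lemma deltas_closed (N : M -> Prop) l g x :
  (forall u v, N u -> N v -> N (u - v)) ->
  (forall m, size m = size l -> N (g (x + \sum_(a <- mask m l) a))) ->
  N (deltas l g x).
Proof.
move=> NB; elim: l x => [|a l IH] x H.
  by have := H [::] erefl; rewrite big_nil addr0.
apply: NB; apply: IH => m sm.
  by have := H (true :: m); rewrite /= big_cons addrA; apply; rewrite sm.
by have := H (false :: m); rewrite /=; apply; rewrite sm.
Qed.

(** In that expansion the full sum occurs with coefficient 1, so its value is the difference minus a
    signed sum over proper subsets. *)
Lemma deltas_top (N : M -> Prop) l g x :
  N 0 -> (forall u v, N u -> N v -> N (u - v)) ->
  N (deltas l g x) ->
  (forall m, size m = size l -> ~~ all id m -> N (g (x + \sum_(a <- mask m l) a))) ->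
  N (g (x + \sum_(a <- l) a)).
Proof.
move=> N0 NB.
have NN u : N u -> N (- u) by move=> /(NB _ _ N0); rewrite sub0r.
have ND u v : N u -> N v -> N (u + v).
  by move=> Nu /NN Nv; rewrite -[v]opprK; apply: NB.
elim: l x => [|a l IH] x /= ND1 H; first by rewrite big_nil addr0.
rewrite big_cons addrA; apply: IH => [|m sm nm].
  rewrite -[deltas _ _ _](subrK (deltas l g x)); apply: ND => //.
  apply: deltas_closed => // m sm.
  by have := H (false :: m); rewrite /=; apply; rewrite ?sm.
by have := H (true :: m); rewrite /= big_cons addrA; apply; rewrite ?sm.
Qed.

(** Differencing along the first K entries, with the sum of the others as base point, leads modulo
    [N] to lists that have lost at least one entry; induction on the length brings it below K. *)
Lemma deltas_reduce (N : M -> Prop) (P : pred E) g K :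
  (0 < K)%N -> N 0 -> (forall u v, N u -> N v -> N (u - v)) ->
  (forall l x, size l = K -> N (deltas l g x)) ->
  (forall l, all P l -> (size l < K)%N -> N (g (\sum_(a <- l) a))) ->
  forall l, all P l -> N (g (\sum_(a <- l) a)).
Proof.
move=> K0 N0 NB ND Ns l; have [n] := ubnP (size l); elim: n l => // n IH l sl Pl.
case: (ltnP (size l) K) => [|Kl]; first exact: Ns.
have skt : size (take K l) = K by rewrite size_takel.
rewrite -{1}(cat_take_drop K l) big_cat /= addrC.
have /andP[Pt Pd] : all P (take K l) && all P (drop K l) by rewrite -all_cat cat_take_drop.
apply: (@deltas_top N) => // [|m sm nm]; first exact: ND.
rewrite addrC -big_cat /=; apply: IH; last first.
  by rewrite all_cat Pd andbT; apply/allP=> a /mem_mask /(allP Pt).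
rewrite size_cat size_mask // size_drop.
have : (count id m < K)%N.
  by rewrite -skt -sm ltn_neqAle count_size andbT -all_count.
lia.
Qed.

End Deltas.

Lemma deltas_comp (E M M' : zmodType) (h : M -> M') (g : E -> M) :
  (forall u v, h (u - v) = h u - h v) ->
  forall l x, h (deltas l g x) = deltas l (h \o g) x.
Proof. by move=> hB; elim=> //= a l IH x; rewrite hB !IH. Qed.

Lemma deltas_map (E E' M : zmodType) (h : E -> E') (g : E' -> M) :
  (forall x y, h (x + y) = h x + h y) ->
  forall l x, deltas l (g \o h) x = deltas (map h l) g (h x).
Proof. by move=> hD; elim=> //= a l IH x; rewrite !IH hD. Qed.

(** * Differences in characteristic p *)

Section CharP.
Variables (p : nat) (pr : prime p) (M : lmodType 'F_p).

(** If X acts as translation by [a], then the difference along [a] is X - 1; the coefficients are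
    those of its k-th power. *)
Lemma deltas_nseq (E : zmodType) k (a : E) (h : E -> M) x :
  deltas (nseq k a) h x =
    \sum_(i < k.+1) (('X - 1) ^+ k : {poly 'F_p})`_i *: h (x + a *+ i).
Proof.
elim: k x => [|k IH] x.
  by rewrite /= big_ord1 expr0 coef1 mulr0n addr0 scale1r.
rewrite /= !{}IH exprS mulrBl mul1r; set Q := (_ ^+ k).
(* [Q] has degree at most k, so the subtracted sum extends to index k + 1 by a zero term. *)
have Q0 : Q`_k.+1 = 0.
  apply: nth_default; rewrite (leq_trans (size_poly_exp_leq _ _)) //.
  by rewrite -['X - 1]/('X - 1%:P) size_XsubC mul1n.
under [RHS]eq_bigr do rewrite coefB scalerBl.
rewrite sumrB; congr (_ - _).
  rewrite [RHS]big_ord_recl coefXM scale0r add0r.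
  by apply: eq_bigr => i _; rewrite coefXM /= mulrS addrA.
by rewrite [RHS]big_ord_recr /= Q0 scale0r addr0.
Qed.

Lemma mulrp0 (E : lmodType 'F_p) (a : E) : a *+ p = 0.
Proof. by rewrite -scaler_nat pchar_Fp_0 ?scale0r. Qed.

(** By Frobenius (X - 1)^p = X^p - 1, and translation by p times [a] is the identity. *)
Lemma deltas_pseq (E : lmodType 'F_p) (a : E) (h : E -> M) x :
  deltas (nseq p a) h x = 0.
Proof.
have chp : p \in [pchar {poly 'F_p}] by rewrite pchar_poly pchar_Fp.
rewrite deltas_nseq; have -> : ('X - 1) ^+ p = 'X^p - 1 :> {poly 'F_p}.
  have := pFrobenius_autB_comm chp (mulrC 'X 1).
  by rewrite !pFrobenius_autE expr1n.
rewrite big_ord_recr (bigD1 (Ordinal (prime_gt0 pr))) //= big1 => [|i ni]; last first.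
  have ni0 : (val i == 0)%N = false := negPf ni.
  by rewrite coefB coefXn coef1 (ltn_eqF (ltn_ord i)) ni0 subrr scale0r.
rewrite mulrp0 !coefB !coefXn !coef1 eqxx (gtn_eqF (prime_gt0 pr)).
by rewrite (ltn_eqF (prime_gt0 pr)) mulr0n addr0 sub0r subr0 scaleN1r scale1r addr0 addNr.
Qed.

(* Pigeonhole: some entry of the list occurs at least p times. *)
Lemma deltas_long (n m : nat) (l : seq 'M['F_p]_(n, m)) (h : 'M['F_p]_(n, m) -> M) x :
  (p * #|{: 'M['F_p]_(n, m)}| <= size l)%N -> deltas l h x = 0.
Proof.
move=> sl; have [a pa] : exists a, (p <= count_mem a l)%N.
  apply/existsP; rewrite -[[exists _, _]]negbK negb_exists; apply/negP=> /forallP H.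
  move: sl; rewrite leqNgt => /negP[].
  have -> : size l = \sum_(a : 'M['F_p]_(n, m)) count_mem a l.
    rewrite -sum1_size (partition_big id predT) //=; apply: eq_bigr => a _.
    by rewrite sum1_count.
  apply: (@leq_ltn_trans (\sum_(a : 'M['F_p]_(n, m)) p.-1)).
    by apply: leq_sum => a _; have := H a; have := prime_gt0 pr; lia.
  rewrite sum_nat_const mulnC ltn_mul2r; apply/andP; split.
    by apply/card_gt0P; exists 0.
  by have := prime_gt0 pr; lia.
(* Differences commute, so p copies of [a] can be moved to the outside. *)
have pe : perm_eq l (nseq p a ++ (nseq (count_mem a l - p) a ++ filter (predC (pred1 a)) l)).
  rewrite catA -nseqD subnKC // -size_filter perm_sym.
  have /all_pred1P <- := filter_all (pred1 a) l.
  by rewrite (perm_filterC (pred1 a)).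
by rewrite (deltas_perm _ _ pe) deltas_cat deltas_pseq.
Qed.

End CharP.

(** * Spans over F_p as finite lists *)

Section Span.
Variables (p : nat) (pr : prime p) (M : lmodType 'F_p).

(** Listing the span with repetitions lets its length p ^ [size s] bound cardinalities without a
    choice of basis. *)
Fixpoint lspan (s : seq M) : seq M :=
  if s is v :: s' then [seq a *: v + y | a <- enum 'F_p, y <- lspan s'] else [:: 0].

Lemma size_lspan s : size (lspan s) = (p ^ size s)%N.
Proof. by elim: s => //= v s IH; rewrite size_allpairs IH -cardE card_Fp // expnS. Qed.

Lemma lspan_consP v s x :
  reflect (exists a, x - a *: v \in lspan s) (x \in lspan (v :: s)).
Proof.
apply: (iffP allpairsP) => [[[a y] /= [_ ys ->]]|[a xs]].
  by exists a; rewrite addrC addKr.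
by exists (a, x - a *: v); split; rewrite /= ?mem_enum // [RHS]addrC subrK.
Qed.

Lemma lspan0 s : 0 \in lspan s.
Proof.
elim: s => [|v s IH]; first by rewrite inE.
by apply/lspan_consP; exists 0; rewrite scale0r subr0.
Qed.

Lemma lspanP s a x y : x \in lspan s -> y \in lspan s -> a *: x + y \in lspan s.
Proof.
elim: s x y => [|v s IH] x y.
  by rewrite !inE => /eqP-> /eqP->; rewrite scaler0 addr0.
move=> /lspan_consP[b xs] /lspan_consP[c ys]; apply/lspan_consP; exists (a * b + c).
by have := IH _ _ xs ys; rewrite scalerBr scalerDl scalerA opprD addrACA.
Qed.

Lemma lspanD s x y : x \in lspan s -> y \in lspan s -> x + y \in lspan s.
Proof. by move=> xs /(lspanP 1 xs); rewrite scale1r. Qed.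

Lemma lspanZ s a x : x \in lspan s -> a *: x \in lspan s.
Proof. by move=> xs; rewrite -[_ *: _]addr0 lspanP // lspan0. Qed.

Lemma mem_lspan s x : x \in s -> x \in lspan s.
Proof.
elim: s => // v s IH; rewrite inE => /orP[/eqP->|/IH xs]; apply/lspan_consP.
  by exists 1; rewrite scale1r subrr lspan0.
by exists 0; rewrite scale0r subr0.
Qed.

Lemma lspan_cat s t x y : x \in lspan s -> y \in lspan t -> x + y \in lspan (s ++ t).
Proof.
elim: s x => [|v s IH] x; first by rewrite inE => /eqP->; rewrite add0r.
move=> /lspan_consP[a xs] yt; apply/lspan_consP; exists a.
by rewrite addrAC IH.
Qed.

Lemma lspan_ind (N : M -> Prop) s : N 0 ->
  (forall a x y, x \in s -> N y -> N (a *: x + y)) -> forall x, x \in lspan s -> N x.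
Proof.
move=> N0; elim: s => [|v s IH] H x; first by rewrite inE => /eqP->.
move=> /lspan_consP[a xs]; rewrite -[x](subrK (a *: v)) addrC.
apply: (H); first exact: mem_head.
by apply: IH xs => b u w us; apply: H; rewrite inE us orbT.
Qed.

End Span.

(** * Growth of functors of finite length *)

Section FunctorGrowth.
Variables (p : nat) (pr : prime p) (V : nat -> lmodType 'F_p).
Variable f : forall m n, 'M['F_p]_(n, m) -> V m -> V n.
Hypothesis Hf : is_Ffunctor f.

Lemma functorB m n A (x y : V m) : f (n := n) A (x - y) = f A x - f A y.
Proof.
case: Hf => fP _ _; have := fP m n A (-1) y x.
by rewrite !scaleN1r !(addrC (- _)).
Qed.

Lemma functor0 m n A : f (n := n) A (0 : V m) = 0.
Proof. by rewrite -(subrr 0) functorB subrr. Qed.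

Lemma subfunctorB S n x y : subfunctor f S -> S n x -> S n y -> S n (x - y).
Proof.
by case=> _ SD SZ _ Sx Sy; rewrite -scaleN1r; apply: SD => //; apply: SZ.
Qed.

Definition span_mod (M : lmodType 'F_p) (S : M -> Prop) (q : seq M) (x : M) :=
  exists y, S y /\ x - y \in lspan q.

(** The pointwise sum of [S] and the span of [Q]. *)
Definition adjoin (S : forall n, V n -> Prop) (Q : forall n, seq (V n)) n :=
  span_mod (S n) (Q n).

Lemma adjoin_subfunctor S Q : subfunctor f S ->
  (forall m n A q, q \in Q m -> f (n := n) A q \in Q n) -> subfunctor f (adjoin S Q).
Proof.
case: (Hf) => fP _ _ [S0 SD SZ Sf] Qf; split.
- by move=> n; exists 0; split=> //; rewrite subrr lspan0.
- move=> n x y [x' [Sx xQ]] [y' [Sy yQ]]; exists (x' + y'); split; first exact: SD.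
  by rewrite opprD addrACA lspanD.
- move=> n a x [x' [Sx xQ]]; exists (a *: x'); split; first exact: SZ.
  by rewrite -scalerBr lspanZ.
- move=> m n A x [x' [Sx xQ]]; exists (f A x'); split; first exact: Sf.
  rewrite -functorB; apply: (lspan_ind (N := fun z => f A z \in _)) xQ.
    by rewrite functor0 lspan0.
  by move=> a u v uQ vQ; rewrite fP lspanP // mem_lspan // Qf.
Qed.

Lemma adjoin_ge S Q : sub_le S (adjoin S Q).
Proof. by move=> n x Sx; exists x; rewrite subrr lspan0. Qed.

Lemma adjoin_mem S Q n x : subfunctor f S -> x \in Q n -> adjoin S Q x.
Proof. by case=> S0 _ _ _ xQ; exists 0; rewrite subr0 mem_lspan. Qed.

Lemma adjoin_le S Q T : subfunctor f T -> sub_le S T ->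
  (forall n x, x \in Q n -> T n x) -> sub_le (adjoin S Q) T.
Proof.
case=> T0 TD TZ _ ST QT n x [y [/ST Ty xQ]]; rewrite -(subrK y x); apply: (TD) => //.
apply: (lspan_ind (N := T n)) xQ => // a u v /QT Tu Tv.
by apply: TD => //; apply: TZ.
Qed.

(** The matrix with row [ir.1] equal to [ir.2] and all other rows zero. *)
Definition row_mx1 n w (ir : 'I_n * 'rV['F_p]_w) : 'M['F_p]_(n, w) :=
  delta_mx ir.1 (0 : 'I_1) *m ir.2.

Lemma row_mx1_sum n w (A : 'M['F_p]_(n, w)) :
  A = \sum_(a <- [seq row_mx1 (i, row i A) | i <- enum 'I_n]) a.
Proof.
rewrite big_map big_enum /=; apply/matrixP=> i j; rewrite summxE (bigD1 i) //= big1.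
  by rewrite mxE big_ord1 !mxE !eqxx mul1r addr0.
by move=> k ki; rewrite mxE big_ord1 !mxE eq_sym (negPf ki) mul0r.
Qed.

(** Padding by [None] encodes lists of length at most K as functions on ['I_K], which are easy to
    count. *)
Lemma sum_padded (I : Type) (E : zmodType) (b : I -> E) K (s : seq I) :
  (size s <= K)%N ->
  \sum_(i <- s) b i = \sum_(j < K) oapp b 0 (nth None (map Some s) j).
Proof.
elim: s K => [|a s IH] K; first by rewrite big_nil big1 // => i _; rewrite nth_nil.
by case: K => // K sK; rewrite big_cons big_ord_recl /= (IH K).
Qed.

(** Take [s] in [T w] outside [S]. By simplicity the elements [f A s] span [T] modulo [S]. Since
    K-fold differences of [h n] fall into [S], [deltas_reduce] leaves only those [A] that are sums
    of fewer than K single-row matrices. *)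
Lemma simple_step_growth S T :
    subfunctor f S -> subfunctor f T -> sub_le S T -> ~ sub_le T S ->
    (forall U, subfunctor f U -> sub_le S U -> sub_le U T -> sub_le U S \/ sub_le T U) ->
  exists c K, forall n, exists t : seq (V n),
    (size t <= c * n.+1 ^ K)%N /\ forall x, T n x -> exists y, S n y /\ x - y \in lspan t.
Proof.
move=> subS subT leST nTS simp; case: (Hf) => fP f1 fM.
have [S0 SD SZ Sf] := subS; have [T0 TD TZ Tf] := subT.
have [w [s [Tw nSw]]] : exists w s, T w s /\ ~ S w s.
  move/existsNP: nTS => [w /existsNP[s /not_implyP]]; by exists w, s.
pose h n A := f (n := n) A s.
pose K := (p * #|{: 'M['F_p]_(w, w)}|)%N.
have K0 : (0 < K)%N.
  by rewrite muln_gt0 prime_gt0 //; apply/card_gt0P; exists 0.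
(* The K-fold differences generate, modulo S, a subfunctor that misses s (they
   vanish at w by [deltas_long]), hence they lie in S by simplicity of T/S. *)
pose Q n := [seq deltas l (h n) x | l <- [seq val l | l <- enum {: K.-tuple 'M['F_p]_(n, w)}],
                x <- enum {: 'M['F_p]_(n, w)}].
have QP n q : reflect (exists l x, size l = K /\ q = deltas l (h n) x) (q \in Q n).
  apply: (iffP allpairsP) => [[[l x] /= [/mapP[t _ ->] _ ->]]|[l [x [sl ->]]]].
    by exists t, x; rewrite size_tuple.
  exists (l, x); split=> //=; rewrite ?mem_enum //; apply/mapP.
  by move/eqP: sl => sl; exists (Tuple sl); rewrite ?mem_enum.
have Qf m n A q : q \in Q m -> f (n := n) A q \in Q n.
  case/QP=> l [x [sl ->]]; apply/QP; exists (map (mulmx A) l), (A *m x).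
  split; first by rewrite size_map.
  rewrite (deltas_comp (h := f A)); last exact: functorB.
  rewrite -(deltas_map (h := mulmx A)); last exact: mulmxDr.
  by congr (deltas _ _ _); apply: funext => B /=; rewrite /h fM.
have QS n q : q \in Q n -> S n q.
  have leR : sub_le (adjoin S Q) S.
    have [] // := simp _ (adjoin_subfunctor subS Qf) (@adjoin_ge S Q).
    - apply: adjoin_le => // m x /QP[l [y [_ ->]]].
      apply: deltas_closed => [u v|b _]; first exact: subfunctorB.
      exact: Tf.
    - move=> /(_ w s Tw) [y [Sy dQ]].
      case: (nSw); rewrite -(subrK y s); apply: (SD) => //.
      apply: (lspan_ind (N := S w)) dQ => // a u v /QP[l [x [sl ->]]] Sv.
      by apply: SD => //; rewrite deltas_long ?sl // scaler0.
  by move=> qQ; apply: leR; apply: adjoin_mem.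
pose g n := [seq h n A | A <- enum {: 'M['F_p]_(n, w)}].
have leTg : sub_le T (adjoin S g).
  have gf m n A q : q \in g m -> f (n := n) A q \in g n.
    case/mapP=> B _ ->; rewrite /h -fM; apply/mapP.
    by exists (A *m B); rewrite ?mem_enum.
  have [] // := simp _ (adjoin_subfunctor subS gf) (@adjoin_ge S g).
  - by apply: adjoin_le => // n x /mapP[A _ ->]; apply: Tf.
  - move=> /(_ w s) H; case: nSw; apply: H; apply: adjoin_mem => //.
    by apply/mapP; exists 1%:M; rewrite ?mem_enum // /h f1.
(* Each of the K slots has 1 + n p^w choices, which is at most p^w (n + 1). *)
exists ((p ^ w) ^ K)%N, K => n.
pose ix := {ffun 'I_K -> option ('I_n * 'rV['F_p]_w)}.
pose t := [seq h n (\sum_(j < K) oapp (@row_mx1 n w) 0 ((u : ix) j)) | u <- enum {: ix}].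
exists t; split.
  rewrite size_map -cardE card_ffun card_ord card_option card_prod card_ord card_mx.
  rewrite card_Fp // mul1n -expnMn leq_exp2r // [leqRHS]mulnC mulSn -add1n leq_add2r expn_gt0.
  by rewrite prime_gt0.
move=> x /leTg [y [Sy xg]].
suff [z [Sz xz]] : span_mod (S n) t (x - y).
  by exists (y + z); rewrite opprD addrA; split=> //; apply: SD.
have N0 : span_mod (S n) t 0 by exists 0; rewrite subrr lspan0.
have NP a u v : span_mod (S n) t u -> span_mod (S n) t v -> span_mod (S n) t (a *: u + v).
  move=> [u' [Su ut]] [v' [Sv vt]]; exists (a *: u' + v'); split.
    by apply: SD => //; apply: SZ.
  by rewrite opprD addrACA -scalerBr lspanP.
apply: (lspan_ind (N := span_mod (S n) t)) xg => // a u v /mapP[A _ ->] Nv.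
apply: (NP) => // {a v Nv y Sy}; rewrite [A]row_mx1_sum.
pose P := [pred B | B \in codom (@row_mx1 n w)].
apply: (@deltas_reduce _ _ (span_mod (S n) t) P (h n) K) => //.
- by move=> u' v Nu Nv; rewrite -scaleN1r addrC; apply: NP.
- move=> l z sl; exists (deltas l (h n) z); rewrite subrr lspan0; split=> //.
  by apply: QS; apply/QP; exists l, z.
- move=> l /allP lP sl.
  have [r rl] : exists r, l = map (@row_mx1 n w) r.
    elim: l {sl} lP => [|B l IH] lP; first by exists [::].
    have /codomP[b ->] := lP _ (mem_head _ _).
    have [|r ->] := IH; last by exists (b :: r).
    by move=> C Cl; apply: lP; rewrite inE Cl orbT.
  rewrite rl big_map (@sum_padded _ _ _ K) -?(size_map (@row_mx1 n w)) -?rl 1?ltnW //.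
  exists 0; split=> //; rewrite subr0 mem_lspan //; apply/mapP.
  exists [ffun j : 'I_K => nth None (map Some r) j]; first by rewrite mem_enum.
  by congr h; apply: eq_bigr => j _; rewrite ffunE.
- by apply/allP=> B /mapP[i _ ->]; apply: codom_f.
Qed.

(** Lists spanning the successive quotients concatenate; adding constants and exponents gives a
    common polynomial bound. *)
Lemma series_growth k S : composition_series f k S ->
  exists c D, forall n, exists t : seq (V n),
    (size t <= c * n.+1 ^ D)%N /\ forall x, x \in lspan t.
Proof.
case=> subS S0 Sk step.
suff [c [D H]] : exists c D, forall n, exists t : seq (V n),
    (size t <= c * n.+1 ^ D)%N /\ forall x, S k n x -> x \in lspan t.
  by exists c, D => n; have [t [st tx]] := H n; exists t; split=> // x; apply: tx.
have: (k <= k)%N by []; elim: {1 3}k => [|i IH] ik.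
  exists 0%N, 0%N => n; exists [::]; split=> // x /S0 ->; exact: lspan0.
have [c1 [D1 H1]] := IH (ltnW ik).
have [le nle simp] := step _ ik.
have [c2 [D2 H2]] := simple_step_growth (subS _ (ltnW ik)) (subS _ ik) le nle simp.
exists (c1 + c2)%N, (D1 + D2)%N => n.
have [t1 [s1 T1]] := H1 n; have [t2 [s2 T2]] := H2 n.
exists (t1 ++ t2); split.
  rewrite size_cat mulnDl; apply: leq_add.
    by apply: leq_trans s1 _; rewrite leq_mul2l leq_pexp2l ?leq_addr ?orbT.
  by apply: leq_trans s2 _; rewrite leq_mul2l leq_pexp2l ?leq_addl ?orbT.
by move=> x /T2 [y [/T1 yt xt]]; rewrite -(subrK y x) addrC lspan_cat.
Qed.

End FunctorGrowth.

(** * Cross effects and finite length *)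

Lemma leq_expl m n e : (m <= n)%N -> (m ^ e <= n ^ e)%N.
Proof. by case: e => // e mn; rewrite leq_exp2r. Qed.

Section CrossEffect.
Variables (p : nat) (X : nat -> eqType).
Variables (op : forall n, X n -> X n -> X n) (e : forall n, X n).
Variable f : forall m n, 'M['F_p]_(n, m) -> X m -> X n.
Hypothesis ope : forall n (x : X n), op x (e n) = x.
Hypothesis eop : forall n (x : X n), op (e n) x = x.
Hypothesis f_op : forall m n A (x y : X m), f (n := n) A (op x y) = op (f A x) (f A y).
Hypothesis f_e : forall m n A, f (n := n) A (e m) = e n.
Hypothesis f_1 : forall n (x : X n), f 1%:M x = x.
Hypothesis f_M : forall l m n (A : 'M['F_p]_(n, m)) (B : 'M['F_p]_(m, l)) x,
  f (A *m B) x = f A (f B x).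

(** The idempotent projecting F^k onto the i-th coordinate hyperplane. *)
Definition kill_mx k (i : 'I_k) : 'M['F_p]_k := diag_mx (\row_j (j != i)%:R).

(** Vanishing of the k-th cross effect. *)
Definition cross_zero k := forall x : X k, (forall i, f (kill_mx i) x = e k) -> x = e k.

(** With F^(kq) read as F^k tensor F^q, this embedding sends e_i to e_i tensor e_(t i), and its
    transpose is a retraction. *)
Definition pick_mx k q (t : {ffun 'I_k -> 'I_q}) : 'M['F_p]_(k, k * q) :=
  \matrix_(i, j) (j == mxvec_index i (t i))%:R.

Lemma pick_mxM k q (t u : {ffun 'I_k -> 'I_q}) :
  pick_mx u *m (pick_mx t)^T = diag_mx (\row_i (u i == t i)%:R).
Proof.
apply/matrixP=> i j; rewrite !mxE (bigD1 (mxvec_index i (u i))) //= !mxE eqxx mul1r.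
rewrite big1 ?addr0 => [|a na]; last by rewrite !mxE (negPf na) mul0r.
have -> : (mxvec_index i (u i) == mxvec_index j (t j)) = ((i, u i) == (j, t j)).
  by rewrite (inj_eq (@cast_ord_inj _ _ _)) (inj_eq enum_rank_inj).
by rewrite xpair_eqE; case: eqP => [->|].
Qed.

Lemma pick_mx_kill k q (t u : {ffun 'I_k -> 'I_q}) i : u i != t i ->
  pick_mx u *m (pick_mx t)^T = pick_mx u *m (pick_mx t)^T *m kill_mx i.
Proof.
move=> ui; rewrite pick_mxM /kill_mx mulmx_diag; congr diag_mx.
apply/rowP=> j; rewrite !mxE; case: (eqVneq j i) => [->|_]; last by rewrite mulr1.
by rewrite (negPf ui) mul0r.
Qed.

(* The elements (pick_mx t)^T x behave like independent coordinates: restricting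
   along pick_mx u recovers x if u = t and gives e otherwise. *)
Lemma cross_count k q (x : X k) : (forall i, f (kill_mx i) x = e k) -> x != e k ->
  exists g : {set {ffun 'I_k -> 'I_q}} -> X (k * q)%N, injective g.
Proof.
move=> kx nx.
pose g (s : seq {ffun 'I_k -> 'I_q}) :=
  foldr (fun t y => op (f (pick_mx t)^T x) y) (e (k * q)%N) s.
have gE s u : uniq s -> f (pick_mx u) (g s) = if u \in s then x else e k.
  elim: s => [|t s IH] /=; first by rewrite f_e.
  case/andP=> ts us; rewrite f_op IH // inE -f_M; case: (eqVneq u t) => [->|nut] /=.
    rewrite (negPf ts) ope pick_mxM.
    have -> : diag_mx (\row_i (t i == t i)%:R) = 1%:M :> 'M['F_p]_k.
      by apply/matrixP=> i j; rewrite !mxE eqxx.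
    exact: f_1.
  have [i ui] : exists i, u i != t i.
    apply/existsP; rewrite -negb_forall; apply: contra nut => /forallP H.
    by apply/eqP/ffunP=> i; apply/eqP.
  by rewrite (pick_mx_kill ui) f_M kx f_e eop.
exists (fun S : {set _} => g (enum S)) => S T eST; apply/setP=> u.
have := congr1 (f (pick_mx u)) eST; rewrite !gE ?enum_uniq // !mem_enum.
by do 2![case: (u \in _)] => // /eqP; rewrite ?(negPf nx) // eq_sym (negPf nx).
Qed.

(** Cardinality is bounded through covering lists because [X n] is merely an [eqType]. *)
Definition enum_growth c D :=
  forall n, exists L : seq (X n), (size L <= p ^ (c * n.+1 ^ D))%N /\ forall x, x \in L.

Lemma cross_vanish c D k : enum_growth c D -> (D < k)%N -> cross_zero k.
Proof.
move=> gr Dk x kx; apply/eqP/negPn/negP => nx.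
(* As kq + 1 is at most (k + 1) q, the exponent p c (kq + 1)^D is at most B q^D, hence below q^(D+1)
   and so below q^k, against the 2^(q^k) elements just produced. *)
pose B := (p * c * k.+1 ^ D)%N; pose q := B.+1.
have [g ginj] := cross_count q kx nx; have [L [sL Lx]] := gr (k * q)%N.
have : (2 ^ (q ^ k) <= 2 ^ (p * (c * (k * q).+1 ^ D)))%N.
  apply: (@leq_trans (p ^ (c * (k * q).+1 ^ D))%N); last first.
    by rewrite [leqRHS]expnM leq_expl // ltnW // ltn_expl.
  apply: leq_trans sL; have <- : #|{set {ffun 'I_k -> 'I_q}}| = (2 ^ (q ^ k))%N.
    by rewrite -cardsT -powersetT card_powerset cardsT card_ffun !card_ord.
  rewrite cardE -(size_map g) uniq_leq_size //.
  by rewrite map_inj_uniq ?enum_uniq.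
rewrite leq_exp2l // leqNgt => /negP; apply.
apply: (@leq_ltn_trans (B * q ^ D)%N).
  rewrite /B -(mulnA (p * c)) -expnMn mulnA leq_mul2l leq_expl ?orbT //.
  by rewrite mulSn -add1n leq_add2r.
apply: (@leq_trans (q ^ D.+1)%N); last by rewrite leq_pexp2l.
by rewrite expnS ltn_mul2r expn_gt0 ltnSn.
Qed.

Lemma kill_mx_rank k (i : 'I_k) : (\rank (kill_mx i) < k)%N.
Proof.
rewrite ltn_neqAle rank_leq_row andbT -[_ == _]/(row_free (kill_mx i)) row_free_unit.
rewrite unitmxE det_diag (bigD1 i) //= mxE eqxx mul0r.
by rewrite unitr0.
Qed.

(** If n is at most D, F^n is a retract of F^D. Otherwise each [kill_mx i] factors through a smaller
    space, where induction applies, so [x] lies in the vanishing cross effect. *)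
Lemma cross_detect D : (forall k, (D < k)%N -> cross_zero k) ->
  forall n (x : X n), (forall a : 'M['F_p]_(D, n), f a x = e D) -> x = e n.
Proof.
move=> cz n; have [N] := ubnP n; elim: N n => // N IH n nN x ax.
case: (leqP n D) => [nD|Dn].
  rewrite -(f_1 x) (_ : 1%:M = (pid_mx n : 'M_(n, D)) *m (pid_mx n : 'M_(D, n))).
    by rewrite f_M ax.
  by rewrite pid_mx_id // pid_mx_1.
apply: cz => // i; rewrite -(mulmx_base (kill_mx i)) f_M.
rewrite (IH _ _ (f (row_base (kill_mx i)) x)) ?f_e // => [|a]; last by rewrite -f_M.
exact: leq_trans (kill_mx_rank i) nN.
Qed.

End CrossEffect.

Lemma count_ltn (T : eqType) (a1 a2 : pred T) s x :
  subpred a1 a2 -> x \in s -> a2 x -> ~~ a1 x -> (count a1 s < count a2 s)%N.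
Proof.
move=> a12; elim: s => // y s IH; rewrite inE => /orP[/eqP<-|xs] a2x a1x /=.
  by rewrite a2x (negPf a1x) ltnS; apply: sub_count.
by rewrite -addnS leq_add ?IH //; case: (a1 y) (a12 y) => // ->.
Qed.

(** * Finite length from polynomial growth *)

Section FiniteLength.
Variables (p : nat) (V : nat -> lmodType 'F_p).
Variable f : forall m n, 'M['F_p]_(n, m) -> V m -> V n.
Hypothesis Hf : is_Ffunctor f.

Lemma functorD m n A (x y : V m) : f (n := n) A (x + y) = f A x + f A y.
Proof. by case: Hf => fP _ _; have := fP m n A 1 x y; rewrite !scale1r. Qed.

Lemma kill_mxC k (i j : 'I_k) : kill_mx p i *m kill_mx p j = kill_mx p j *m kill_mx p i.
Proof. exact: diag_mxC. Qed.

Lemma kill_mx_id k (i : 'I_k) : kill_mx p i *m kill_mx p i = kill_mx p i.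
Proof.
rewrite /kill_mx mulmx_diag; congr diag_mx; apply/rowP=> j; rewrite !mxE.
by case: (j != i); rewrite ?mulr1 ?mulr0.
Qed.

(** The induction of [cross_detect] carried out modulo [S]: [x] is corrected by elements of [S n]
    until it dies on all hyperplanes. *)
Lemma subfunctor_detect D S :
  (forall k, (D < k)%N -> cross_zero (fun n => 0 : V n) f k) -> subfunctor f S ->
  forall n x, (forall a : 'M['F_p]_(D, n), S D (f a x)) -> S n x.
Proof.
move=> cz subS n; have [N] := ubnP n; elim: N n => // N IH n nN x ax.
have [S0 SD SZ Sf] := subS; have [fP f1 fM] := Hf.
case: (leqP n D) => [nD|Dn].
  rewrite -(f1 _ x) (_ : 1%:M = (pid_mx n : 'M_(n, D)) *m (pid_mx n : 'M_(D, n))).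
    by rewrite fM; apply: Sf.
  by rewrite pid_mx_id // pid_mx_1.
have Skill i : S n (f (kill_mx p i) x).
  rewrite -(mulmx_base (kill_mx p i)) fM; apply: Sf; apply: IH => [|a].
    exact: leq_trans (kill_mx_rank p i) nN.
  by rewrite -fM.
(* y is the product of the commuting idempotents 1 - E_i, E_i = [kill_mx i], applied to x. *)
have [y [Sy ky]] : exists y, S n (y - x) /\ forall i, i \in enum 'I_n -> f (kill_mx p i) y = 0.
  elim: (enum 'I_n) => [|j s [y [Sy ky]]].
    by exists x; split=> [|i] //; rewrite subrr; exact: S0.
  exists (y - f (kill_mx p j) y); split=> [|i].
    rewrite addrAC; apply: (subfunctorB subS) => //.
    by rewrite -(subrK x y) functorD; apply: SD => //; apply: Sf.
  rewrite functorB // -fM inE => /orP[/eqP->|si]; first by rewrite kill_mx_id subrr.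
  by rewrite kill_mxC fM ky // functor0 // subrr.
have y0 : y = 0 by apply: cz Dn _ _ => i; apply: ky; rewrite mem_enum.
by have := SZ n (-1) _ Sy; rewrite y0 sub0r scaleN1r opprK.
Qed.

Section Series.
Variables (D : nat) (L : seq (V D)).
Hypothesis Lx : forall x, x \in L.
Hypothesis detect : forall S, subfunctor f S ->
  forall n x, (forall a : 'M['F_p]_(D, n), S D (f a x)) -> S n x.

(** By detection a strict inclusion of subfunctors is already strict at F^D, so this count is a
    strictly increasing invariant bounded by [size L]. *)
Definition weight (S : forall n, V n -> Prop) := count (fun x => `[< S D x >]) L.

Lemma weight_lt S T : subfunctor f S -> subfunctor f T -> sub_le S T -> ~ sub_le T S ->
  (weight S < weight T)%N.
Proof.
move=> subS [_ _ _ Tf] ST /existsNP[n /existsNP[x /not_implyP[Tx nSx]]].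
have [a nSa] : exists a : 'M['F_p]_(D, n), ~ S D (f a x).
  by apply/existsNP => H; apply: nSx; apply: detect.
apply: (count_ltn (x := f a x)) => //; last by apply/asboolPn.
  by move=> y /asboolP Sy; apply/asboolP; apply: ST.
by apply/asboolP; apply: Tf.
Qed.

Lemma zero_subfunctor : subfunctor f (fun n x => x = 0).
Proof.
split=> // [n x y -> ->|n a x ->|m n A x ->]; rewrite ?addr0 ?scaler0 //.
exact: functor0.
Qed.

(** A proper subfunctor of [T] of largest weight is maximal, so [T] can be placed on top of a series
    for it; induction on the weight. *)
Lemma series_exists T : subfunctor f T -> exists k S,
  [/\ (forall i, (i <= k)%N -> subfunctor f (S i)), (forall n x, S 0%N n x <-> x = 0),
      S k = T &
      (forall i, (i < k)%N ->
         [/\ sub_le (S i) (S i.+1), ~ sub_le (S i.+1) (S i) &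
             forall T, subfunctor f T -> sub_le (S i) T -> sub_le T (S i.+1) ->
               sub_le T (S i) \/ sub_le (S i.+1) T])].
Proof.
have [m] := ubnP (weight T); elim: m T => // m IH T wT subT.
have [T0 _ _ _] := subT.
have [Tz|nTz] := pselect (sub_le T (fun n x => x = 0)).
  exists 0%N, (fun _ => T); split=> // n x; split=> [/Tz //|->]; exact: T0.
pose P j := `[< exists U, [/\ subfunctor f U, sub_le U T, ~ sub_le T U & weight U = j] >].
have exP : exists j, P j.
  exists (weight (fun n x => x = 0)); apply/asboolP; exists (fun n x => x = 0).
  split=> //; [exact: zero_subfunctor|by move=> n x ->].
have ubP j : P j -> (j <= size L)%N by move=> /asboolP[U [_ _ _ <-]]; apply: count_size.
case: (ex_maxnP exP ubP) => j /asboolP[U [subU leUT nTU wU]] jmax.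
have [|k [S [subS S0 Sk step]]] := IH U _ subU.
  by rewrite ltnS in wT; apply: leq_trans (weight_lt subU subT leUT nTU) wT.
exists k.+1, (fun i => if (i <= k)%N then S i else T); split.
- by move=> i _; case: ifP => // /subS.
- exact: S0.
- by rewrite ltnn.
- move=> i; rewrite ltnS leq_eqVlt => /orP[/eqP->|ik]; last first.
    by rewrite ik orbT; apply: step.
  rewrite eqxx ltnn Sk; split=> // W subW UW WT.
  have [TW|nTW] := pselect (sub_le T W); [by right|left; apply: contrapT => nWU].
  have := weight_lt subU subW UW nWU; rewrite wU ltnNge jmax //.
  by apply/asboolP; exists W.
Qed.

End Series.

Lemma growth_series c D : enum_growth p V c D -> exists k S, composition_series f k S.
Proof.
move=> gr; have [fP f1 fM] := Hf.
have cz k : (D < k)%N -> cross_zero (fun n => 0 : V n) f k.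
  move=> Dk; apply: (cross_vanish (op := fun n => +%R)) gr Dk => //.
  - by move=> n x; rewrite addr0.
  - by move=> n x; rewrite add0r.
  - exact: functorD.
  - by move=> m n A; rewrite functor0.
have [L [_ Lx]] := gr D.
have [|k [S [subS S0 Sk step]]] :=
  series_exists Lx (fun S subS => subfunctor_detect cz subS) (T := fun _ _ => True).
  by split.
by exists k, S; split=> // n x; rewrite Sk.
Qed.

End FiniteLength.

(** * Nilpotence of the augmentation ideal *)

Section PGroupNilpotent.
Variables (p : nat) (F : fieldType) (gT : finGroupType) (P : {group gT}) (n : nat).
Variable rG : mx_representation F P n.
Hypotheses (chF : p \in [pchar F]) (pP : (p.-group P)%g).

(** The image under [rG] of a product of elements x - 1 of the augmentation ideal. *)
Definition aug_prod (l : seq gT) : 'M[F]_n :=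
  foldr (fun x A => (rG x - 1%:M) *m A) 1%:M l.

(** A p-group acting on a nonzero space in characteristic p has nonzero fixed vectors; [W] is the
    preimage of those of the quotient by [U]. *)
Lemma pgroup_submodule_step (U : 'M[F]_n) : mxmodule rG U -> (\rank U < n)%N ->
  exists W : 'M[F]_n, [/\ mxmodule rG W, (\rank U < \rank W)%N &
    {in P, forall x, W *m (rG x - 1%:M) <= U}%MS].
Proof.
move=> modU rU; pose rQ := factmod_repr modU; pose Q := rfix_mx rQ P.
have Q0 : Q != 0.
  apply: (rfix_pgroup_pchar chF) => //.
  by rewrite mxrank_coker subn_gt0.
pose W := (U + val_factmod (U := U) Q)%MS.
have WU : {in P, forall x, W *m (rG x - 1%:M) <= U}%MS.
  move=> x Px; rewrite addsmxMr addsmx_sub; apply/andP; split.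
    rewrite mulmxBr mulmx1 addmx_sub ?eqmx_opp //.
    exact: (mxmoduleP modU).
  rewrite -in_factmod_eq0 mulmxBr mulmx1 linearB /= in_factmodJ // val_factmodK.
  have -> : Q *m factmod_mx modU x = Q by apply: (rfix_mxP (rG := rQ) P _) => //.
  by rewrite subrr.
exists W; split=> //.
  apply/mxmoduleP=> x Px; rewrite -[rG x](subrK 1%:M) mulmxDr mulmx1 addmx_sub //.
  by apply: submx_trans (WU x Px) _; apply: addsmxSl.
rewrite -mxrank_in_factmod val_factmodK -[ltnLHS]add0n ltn_add2r lt0n mxrank_eq0 //.
Qed.

(** The previous step gives a chain of submodules whose k-th term is killed by products of length k;
    ranks grow until the whole space is reached, after at most n steps. *)
Lemma pgroup_aug_nilpotent l : all (mem P) l -> size l = n -> aug_prod l = 0.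
Proof.
suff H k : exists U : 'M[F]_n, [/\ mxmodule rG U, (minn k n <= \rank U)%N &
    forall l, all (mem P) l -> size l = k -> U *m aug_prod l = 0].
  move=> Pl sl; have [U [_ rU Ul]] := H n.
  rewrite minnn in rU; have Ufull : U \in unitmx.
    by rewrite -row_full_unit /row_full eqn_leq rank_leq_col.
  by rewrite -[aug_prod l](mulKmx Ufull) Ul ?mulmx0.
elim: k => [|k [U [modU rU Ul]]].
  by exists 0; split=> [||l' _ _]; rewrite ?mxmodule0 ?min0n ?mul0mx.
case: (ltnP (\rank U) n) => rUn.
  have [W [modW rW WU]] := pgroup_submodule_step modU rUn.
  exists W; split=> // [|[|x l'] //= /andP[Px Pl'] [sl']]; first by lia.
  have /submxP[C CE] := WU x Px.
  by rewrite mulmxA CE -mulmxA Ul ?mulmx0.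
exists U; split=> // [|[|x l'] //= /andP[Px Pl'] [sl']]; first by lia.
have /submxP[C CE] := mxmoduleP modU x Px.
by rewrite mulmxA mulmxBr mulmx1 CE mulmxBl -mulmxA Ul // mulmx0 subr0.
Qed.

End PGroupNilpotent.

(** By Lagrange, adjoining an element outside a subgroup at least doubles its order. *)
Lemma small_generating_seq (gT : finGroupType) e : (#|gT| < 2 ^ e)%N ->
  exists Y : seq gT, (size Y <= e)%N /\ forall x, x \in <<[set y in Y]>>%g.
Proof.
suff H k : exists Y : seq gT, (size Y <= k)%N /\
    ((forall x, x \in <<[set y in Y]>>%g) \/ (2 ^ k <= #|<<[set y in Y]>>%g|)%N).
  move=> le; have [Y [sY [YG|leY]]] := H e; exists Y; split=> // x.
  by have := leq_trans leY (max_card _); rewrite leqNgt le.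
elim: k => [|k [Y [sY HY]]]; first by exists [::]; split=> //; right; rewrite cardG_gt0.
have [YG|nYG] := pselect (forall x, x \in <<[set y in Y]>>%g).
  by exists Y; split; [apply: leqW|left].
case: HY => // leY; move/existsNP: nYG => [x /negP xY].
exists (x :: Y); split=> //; right.
have sub : <<[set y in Y]>>%g \subset <<[set y in x :: Y]>>%g.
  by apply: genS; apply/subsetP=> y; rewrite !inE => ->; rewrite orbT.
have := Lagrange sub; set i := #|_ : _|%g => <-.
rewrite expnS mulnC leq_mul // ltn_neqAle eq_sym indexg_gt0 andbT indexg_eq1.
apply: contra xY => /subsetP; apply; apply: mem_gen.
by rewrite !inE eqxx.
Qed.

(** * Linear embedding of a presheaf of p-groups *)

Section GroupEmbedding.
Variables (p : nat) (pr : prime p) (G : gpresheaf p).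
Hypothesis pG : forall n, (p.-group [set: g_obj G n])%g.

Local Notation gm A x := (@g_map p G _ _ A x).

Lemma g_map_1 m n (A : 'M['F_p]_(n, m)) : gm A 1%g = 1%g.
Proof. by apply: (mulgI (gm A 1%g)); rewrite -g_mapM !mulg1. Qed.

Lemma g_map_V m n (A : 'M['F_p]_(n, m)) x : gm A (x^-1)%g = ((gm A x)^-1)%g.
Proof. by apply: (mulgI (gm A x)); rewrite -g_mapM !mulgV g_map_1. Qed.

Definition group_growth c D := forall n, (#|g_obj G n| <= p ^ (c * n.+1 ^ D))%N.

Lemma group_detect c D : group_growth c D ->
  forall n (x y : g_obj G n), (forall a : 'M['F_p]_(D, n), gm a x = gm a y) -> x = y.
Proof.
move=> gr n x y xy; suff: (x * y^-1)%g = 1%g by move/(canRL (mulgKV _)); rewrite mul1g.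
pose X n : eqType := g_obj G n; pose e n : X n := 1%g.
have cz k : (D < k)%N -> @cross_zero p X e (@g_map p G) k.
  move=> Dk; apply: (@cross_vanish p X (fun n => @mulg (g_obj G n)) e _ _ _ _ _ _ _ c D) => //.
  - by move=> ? ?; rewrite mulg1.
  - by move=> ? ?; rewrite mul1g.
  - exact: g_mapM.
  - exact: g_map_1.
  - exact: g_map1.
  - exact: g_mapC.
  - move=> m; exists (enum (g_obj G m)); rewrite -cardE; split; first exact: gr.
    by move=> z; rewrite mem_enum.
apply: (@cross_detect p X e (@g_map p G) _ _ _ D) => //.
- exact: g_map_1.
- exact: g_map1.
- exact: g_mapC.
- by move=> a; rewrite g_mapM g_map_V xy mulgV.
Qed.

Section Representation.
Variable D : nat.
Hypothesis detect : forall n (x y : g_obj G n),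
  (forall a : 'M['F_p]_(D, n), gm a x = gm a y) -> x = y.

Let N := gcard [set: g_obj G D].
Let rho : mx_representation 'F_p [set: g_obj G D] N := regular_repr 'F_p [set: g_obj G D]%G.
(** The algebra of matrix-valued functions on Hom(F^D, F^n), with pointwise product [rep_mul] and
    unit [rep_fun 1]; precomposition makes it a functor of n. *)
Let J n := {ffun 'M['F_p]_(D, n) -> 'M['F_p]_N}.

Definition rep_fun n (x : g_obj G n) : J n := [ffun a => rho (gm a x)].
Definition rep_mul n (u v : J n) : J n := [ffun a => u a *m v a].
Definition rep_pull m n (A : 'M['F_p]_(n, m)) (u : J m) : J n := [ffun a => u (a *m A)].

Lemma rep_fun_inj n : injective (@rep_fun n).
Proof.
move=> x y /ffunP exy; apply: detect => a; have := exy a; rewrite !ffunE.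
by apply: (mx_faithful_inj (regular_mx_faithful _ _)); rewrite inE.
Qed.

Lemma rep_funM n (x y : g_obj G n) : rep_fun (x * y)%g = rep_mul (rep_fun x) (rep_fun y).
Proof. by apply/ffunP=> a; rewrite !ffunE g_mapM repr_mxM ?inE. Qed.

Lemma rep_pull_fun m n A (x : g_obj G m) : rep_pull A (rep_fun x) = rep_fun (gm A x) :> J n.
Proof. by apply/ffunP=> a; rewrite !ffunE g_mapC. Qed.

Fixpoint rep_words n (Y : seq (g_obj G n)) j : seq (J n) :=
  if j is j'.+1 then
    [seq rep_mul (rep_fun y - rep_fun 1%g) w | y <- Y, w <- rep_words Y j']
  else [:: rep_fun 1%g].

(** At each [a] a word of length j is an [aug_prod] of j elements of G(F^D), and N is the dimension
    of [rho]. *)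
Lemma rep_words_nilpotent n Y j w : j = N -> w \in @rep_words n Y j -> w = 0.
Proof.
suff H a : w \in rep_words Y j ->
    exists l, size l = j /\ w a = aug_prod rho l.
  move=> jN wN; apply/ffunP=> a; have [l [sl ->]] := H a wN; rewrite ffunE.
  apply: (pgroup_aug_nilpotent (p := p)); rewrite ?sl ?pchar_Fp //.
  by apply/allP=> x; rewrite /= inE.
elim: j w => [|j IH] w /=.
  rewrite inE => /eqP->; exists [::]; rewrite ffunE g_map_1.
  by split=> //; apply: repr_mx1.
case/allpairsP=> [[y w'] /= [_ /IH [l [sl wE]] ->]].
exists (gm a y :: l); rewrite /= sl; split=> //.
rewrite !ffunE wE g_map_1; congr ((_ - _) *m _); exact: repr_mx1.
Qed.

Definition rep_spanning n (Y : seq (g_obj G n)) := flatten [seq rep_words Y j | j <- iota 0 N].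

Lemma size_rep_spanning n (Y : seq (g_obj G n)) :
  (size (rep_spanning Y) <= N * (size Y).+1 ^ N)%N.
Proof.
have sw j : size (rep_words Y j) = (size Y ^ j)%N.
  by elim: j => //= j IH; rewrite size_allpairs IH expnS.
rewrite size_flatten /shape -map_comp sumnE big_map.
apply: (@leq_trans (\sum_(j <- iota 0 N) (size Y).+1 ^ N)%N); last first.
  by rewrite big_const_seq count_predT size_iota iter_addn_0 mulnC.
rewrite big_seq [leqRHS]big_seq; apply: leq_sum => j; rewrite mem_iota => /andP[_ jN].
rewrite /= sw; apply: (@leq_trans ((size Y).+1 ^ j)%N); first exact: leq_expl.
by rewrite leq_pexp2l // ltnW.
Qed.

Lemma rep_mulDl n (u v w : J n) : rep_mul (u + v) w = rep_mul u w + rep_mul v w.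
Proof. by apply/ffunP=> a; rewrite !ffunE mulmxDl. Qed.

Lemma rep_mulP n (u v w : J n) c : rep_mul u (c *: v + w) = c *: rep_mul u v + rep_mul u w.
Proof. by apply/ffunP=> a; rewrite !ffunE mulmxDr scalemxAr. Qed.

Lemma rep_mul1 n (w : J n) : rep_mul (rep_fun 1%g) w = w.
Proof. by apply/ffunP=> a; rewrite !ffunE g_map_1 repr_mx1 mul1mx. Qed.

(** Writing y = (y - 1) + 1 turns a word into itself plus a word one letter longer, which vanishes
    once its length is N. *)
Lemma rep_spanning_mul n Y y (w : J n) : y \in Y -> w \in lspan (rep_spanning Y) ->
  rep_mul (rep_fun y) w \in lspan (rep_spanning Y).
Proof.
move=> yY; apply: (lspan_ind (N := fun w => rep_mul (rep_fun y) w \in _)).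
  by rewrite (_ : rep_mul _ _ = 0) ?lspan0 //; apply/ffunP=> a; rewrite !ffunE mulmx0.
move=> c u v us vs; rewrite rep_mulP lspanP // -[rep_fun y](subrK (rep_fun 1%g)).
rewrite rep_mulDl rep_mul1 lspanD ?(mem_lspan us) //.
have [s /mapP[j]] := flattenP us; rewrite mem_iota add0n => /andP[_ jN] -> uj.
have uj1 : rep_mul (rep_fun y - rep_fun 1%g) u \in rep_words Y j.+1.
  by apply/allpairsP; exists (y, u).
move: jN; rewrite leq_eqVlt => /orP[/eqP jN|jN].
  by rewrite (rep_words_nilpotent jN uj1) lspan0.
apply: mem_lspan; apply/flattenP; exists (rep_words Y j.+1) => //.
by apply/mapP; exists j.+1; rewrite ?mem_iota.
Qed.

Lemma rep_fun_spanning n Y (x : g_obj G n) : x \in <<[set y in Y]>>%g ->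
  rep_fun x \in lspan (rep_spanning Y).
Proof.
(* In a finite group, products of generators suffice without inverses, so stability under left
   multiplication is enough. *)
case/gen_prodgP=> k [c cY ->]; elim: k c cY => [|k IH] c cY.
  rewrite big_ord0; apply: mem_lspan; apply/flattenP.
  exists (rep_words Y 0); last by rewrite inE.
  by apply/mapP; exists 0%N; rewrite ?mem_iota //= add0n cardG_gt0.
rewrite big_ord_recl rep_funM; apply: rep_spanning_mul; last exact: IH.
by have := cY ord0; rewrite inE.
Qed.

(** [J n] has dimension p^(Dn) N^2, too large for polynomial growth; the span of the image of [G] is
    a small enough subfunctor. *)
Definition rep_space n : {vspace J n} := <<[seq rep_fun x | x <- enum (g_obj G n)]>>%VS.
Definition rep_obj n : lmodType 'F_p := subvs_of (rep_space n).
Definition rep_map m n (A : 'M['F_p]_(n, m)) (u : rep_obj m) : rep_obj n :=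
  vsproj (rep_space n) (rep_pull A (vsval u)).

Lemma mem_rep_space n (x : g_obj G n) : rep_fun x \in rep_space n.
Proof. by apply: memv_span; apply/mapP; exists x; rewrite ?mem_enum. Qed.

Lemma rep_space_ind n (P : J n -> Prop) : P 0 ->
  (forall c x u, P u -> P (c *: rep_fun x + u)) -> forall u, u \in rep_space n -> P u.
Proof.
move=> P0 PD u; rewrite /rep_space; set s := map _ _ => us.
rewrite (coord_span (X := in_tuple s) us); apply: big_rec => // i v _ Pv.
have /mapP[x _ ->] : s`_i \in s by rewrite mem_nth.
exact: PD.
Qed.

Lemma rep_pullP m n A c (u v : J m) :
  rep_pull A (c *: u + v) = c *: rep_pull A u + rep_pull A v :> J n.
Proof. by apply/ffunP=> a; rewrite !ffunE. Qed.

Lemma rep_pull_space m n A u : u \in rep_space m -> (rep_pull A u : J n) \in rep_space n.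
Proof.
apply: (rep_space_ind (P := fun u => rep_pull A u \in _)).
  by rewrite (_ : rep_pull A 0 = 0) ?mem0v //; apply/ffunP=> a; rewrite !ffunE.
by move=> c x v vs; rewrite rep_pullP rep_pull_fun rpredD ?rpredZ ?mem_rep_space.
Qed.

Lemma val_rep_map m n (A : 'M['F_p]_(n, m)) (u : rep_obj m) :
  vsval (rep_map A u) = rep_pull A (vsval u) :> J n.
Proof. by rewrite vsprojK // rep_pull_space // subvsP. Qed.

Lemma rep_map_functor : is_Ffunctor rep_map.
Proof.
split=> [m n A c u v|n u|l m n A B u]; apply: subvs_inj.
- by rewrite val_rep_map !linearP /= rep_pullP !val_rep_map.
- by rewrite val_rep_map; apply/ffunP=> a; rewrite ffunE mulmx1.
- by rewrite !val_rep_map; apply/ffunP=> a; rewrite !ffunE mulmxA.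
Qed.

Lemma rep_obj_enum n e : (#|g_obj G n| < 2 ^ e)%N ->
  exists L : seq (rep_obj n), (size L <= p ^ (N * e.+1 ^ N))%N /\ forall x, x \in L.
Proof.
case/small_generating_seq=> Y [sY YG].
exists [seq vsproj (rep_space n) w | w <- lspan (rep_spanning Y)]; split.
  rewrite size_map size_lspan // leq_pexp2l ?prime_gt0 //.
  by apply: leq_trans (size_rep_spanning Y) _; rewrite leq_mul2l leq_expl ?orbT.
move=> u; rewrite -[u]vsvalK; apply: map_f.
apply: (rep_space_ind (P := fun v => v \in lspan _)) (subvsP u); first exact: lspan0.
by move=> c x v vs; rewrite lspanP // rep_fun_spanning.
Qed.

End Representation.

Lemma group_growth_finite c D : group_growth c D -> finite_underlying G.
Proof.
move=> gr; have detect := group_detect gr.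
exists (rep_obj D), (@rep_map D); split; last first.
  exists (fun n x => vsproj (rep_space D n) (rep_fun D x)); split=> [n x y|m n A x].
    move/(congr1 vsval); rewrite !vsprojK ?mem_rep_space //; exact: rep_fun_inj.
  apply: subvs_inj; rewrite val_rep_map !vsprojK ?mem_rep_space //.
  by rewrite rep_pull_fun.
split; first exact: rep_map_functor.
set N := gcard [set: g_obj G D].
(* With M = c (n+1)^D the order of the group is at most p^M, below 2^(pM+1). So e = pM + 1 in
   [rep_obj_enum], and e + 1 is at most (pc + 2) (n+1)^D. *)
apply: (growth_series (@rep_map_functor D) (c := (N * (p * c).+2 ^ N)%N) (D := (D * N)%N)).
move=> n; pose M := (c * n.+1 ^ D)%N.
have [|L [sL Lx]] := @rep_obj_enum D n (p * M).+1.
  apply: (@leq_ltn_trans (2 ^ (p * M))%N); last by rewrite ltn_exp2l.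
  by apply: leq_trans (gr n) _; rewrite [leqRHS]expnM leq_expl // ltnW // ltn_expl.
exists L; split=> //; apply: leq_trans sL _.
rewrite leq_pexp2l ?prime_gt0 // -mulnA leq_mul2l expnM -expnMn leq_expl ?orbT //.
rewrite /M mulnA -addn2 -(addn2 (p * c)) mulnDl leq_add2l.
by rewrite leq_pmulr // expn_gt0.
Qed.

End GroupEmbedding.

(** * The Frattini filtration and its graded functor *)

Section FrattiniSeries.
Variables (p : nat) (pr : prime p) (gT : finGroupType).
Hypothesis pG : (p.-group [set: gT])%g.
Local Open Scope group_scope.

Local Notation Phi_ k := (PhiN p gT k).

Lemma PhiN_group_set k : group_set (Phi_ k).
Proof. by case: k => [|k]; apply: groupP. Qed.
Canonical PhiN_group k := Group (PhiN_group_set k).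

(** In a p-group the Frattini subgroup is generated by the commutators and the p-th powers. *)
Lemma PhiP_Frattini (H : {group gT}) : PhiP p H = 'Phi(H).
Proof.
have pH : p.-group H := pgroupS (subsetT H) pG.
by rewrite (Phi_joing pH) joing_idl (MhoE 1 pH) joing_idr expn1.
Qed.

Lemma PhiN_S k : Phi_ k.+1 = 'Phi(Phi_ k).
Proof. exact: (PhiP_Frattini (PhiN_group k)). Qed.

Lemma PhiN_sub k : Phi_ k.+1 \subset Phi_ k.
Proof. by rewrite PhiN_S Phi_sub. Qed.

Lemma PhiN_norm k : Phi_ k \subset 'N(Phi_ k.+1).
Proof. by rewrite PhiN_S normal_norm ?Phi_normal. Qed.

Lemma grQ_abelem k : p.-abelem (grQ p gT k).
Proof.
have pk : p.-group (Phi_ k) := pgroupS (subsetT _) pG.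
by rewrite /grQ PhiN_S (Phi_quotient_abelem (P := PhiN_group k) pk).
Qed.

Lemma card_grQ k : #|grQ p gT k| = (p ^ grdim p gT k)%N.
Proof. exact: card_pgroup (abelem_pgroup (grQ_abelem k)). Qed.

Lemma card_PhiN k : (#|Phi_ k| = #|Phi_ k.+1| * p ^ grdim p gT k)%N.
Proof. by rewrite -card_grQ card_quotient ?PhiN_norm // Lagrange ?PhiN_sub. Qed.

(** The Frattini subgroup of a nontrivial group is proper, so the order drops by at least one at
    each step. *)
Lemma PhiN_trivial k : (#|gT| <= k)%N -> Phi_ k = 1.
Proof.
suff [->//|le] : Phi_ k = 1 \/ (#|Phi_ k| + k <= #|gT|)%N.
  move=> lek; have := leq_trans le lek; rewrite -[leqRHS]add0n leq_add2r.
  by rewrite leqNgt (cardG_gt0 (PhiN_group k)).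
elim: k => [|k [IH|IH]]; first by right; rewrite addn0 max_card.
  by left; apply/trivgP; apply: subset_trans (PhiN_sub k) _; rewrite IH.
have [->|nt] := eqVneq (Phi_ k.+1) 1; [by left|right].
have nt' : Phi_ k :!=: 1.
  by apply: contra nt => /eqP k1; rewrite -subG1 -k1 PhiN_sub.
have := proper_card (Phi_proper (G := PhiN_group k) nt'); rewrite /= -PhiN_S => lt.
by apply: leq_trans IH; rewrite addnS ltn_add2r.
Qed.

Lemma grdim_sum k : (#|Phi_ k| * p ^ (\sum_(i < k) grdim p gT i) = #|gT|)%N.
Proof.
elim: k => [|k IH]; first by rewrite big_ord0 muln1 cardsT.
by rewrite big_ord_recr /= addnC expnD mulnA -card_PhiN.
Qed.

Lemma card_grdim : (p ^ (\sum_(i < #|gT|) grdim p gT i) = #|gT|)%N.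
Proof. by rewrite -[RHS](grdim_sum #|gT|) PhiN_trivial // cards1 mul1n. Qed.

Lemma grdim_trivial k : (#|gT| <= k)%N -> grdim p gT k = 0%N.
Proof.
move=> le; apply/eqP; rewrite -(eqn_exp2l _ _ (prime_gt1 pr)) -card_grQ.
by rewrite /grQ (PhiN_trivial le) quotient1 cards1.
Qed.

End FrattiniSeries.

(** * Coordinates on elementary abelian groups *)

Section Coordinates.
Variables (p : nat) (pr : prime p) (cT : finGroupType) (Q : {group cT}).
Hypothesis abQ : (p.-abelem Q)%g.

(** An elementary abelian group of order p^d is isomorphic to F_p^d; hence the default values in
    [coordf] and [uncoordf] never occur here. *)
Lemma coord_exists : exists c : {ffun cT -> 'rV['F_p]_(logn p #|Q|)}, is_coord Q c.
Proof.
set d := logn p #|Q|; pose E := [set: 'rV['F_p]_d].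
have abE : (p.-abelem E)%g.
  apply/(abelemP pr); split; first exact: FinRing.zmod_abelian.
  by move=> x _; rewrite FinRing.zmodXgE mulrp0.
have : (Q \isog E)%g.
  rewrite (isog_abelem_card _ abQ) abE /= cardsT card_mx card_Fp // mul1n.
  by rewrite (card_pgroup (abelem_pgroup abQ)).
case/isogP=> h /injmP hinj himg; exists (finfun h); apply/and3P; split.
- by do 2![apply/forall_inP=> ? ?]; rewrite !ffunE morphM.
- apply/forallP=> v; have /morphimP[x _ xQ ->] : v \in (h @* Q)%g by rewrite himg inE.
  apply/existsP; exists x.
  by rewrite xQ ffunE eqxx.
- apply/forall_inP=> x xQ; apply/forall_inP=> y yQ; apply/implyP.
  by rewrite !ffunE => /eqP /hinj ->.
Qed.

Lemma coordfP : is_coord Q (finfun (coordf p Q)).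
Proof.
rewrite /coordf; case: pickP => [c cP|none] /=.
  by rewrite (_ : finfun c = c) //; apply/ffunP=> x; rewrite ffunE.
by have [c] := coord_exists; rewrite none.
Qed.

Lemma coordfM : {in Q &, forall x y, coordf p Q (x * y)%g = coordf p Q x + coordf p Q y}.
Proof.
move=> x y xQ yQ; have /and3P[/forall_inP/(_ x xQ)/forall_inP/(_ y yQ)/eqP H _ _] := coordfP.
by rewrite !ffunE in H.
Qed.

Lemma coordf_inj : {in Q &, injective (coordf p Q)}.
Proof.
move=> x y xQ yQ xy; have /and3P[_ _ /forall_inP/(_ x xQ)/forall_inP/(_ y yQ)] := coordfP.
by rewrite !ffunE xy eqxx => /eqP.
Qed.

Lemma uncoordfP (v : 'rV['F_p]_(logn p #|Q|)) : uncoordf v \in Q /\ coordf p Q (uncoordf v) = v.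
Proof.
rewrite /uncoordf; case: pickP => [x /andP[xQ /eqP //]|none] /=.
have /and3P[_ /forallP/(_ v)/existsP[x /andP[xQ cx]] _] := coordfP.
by move: cx; rewrite ffunE => cx; have := none x; rewrite /= xQ cx.
Qed.

Lemma coordfK x : x \in Q -> uncoordf (coordf p Q x) = x.
Proof. by move=> xQ; have [uQ /coordf_inj] := uncoordfP (coordf p Q x); apply. Qed.

End Coordinates.

(** Evaluates the matches on [idP] in [gr_map], where the proof inside [Ordinal] is immaterial. *)
Lemma reflect_match_true (T : Type) P b (r : reflect P b) (F : P -> T) d (hP : P) :
  match r with ReflectT h => F h | ReflectF _ => d end = F hP.
Proof. by case: r => // h; congr F; apply: Prop_irrelevance. Qed.

Lemma reflect_match_false (T : Type) P b (r : reflect P b) (F : P -> T) d : ~ P ->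
  match r with ReflectT h => F h | ReflectF _ => d end = d.
Proof. by case: r. Qed.

(** * The associated graded functor and comparison of growth *)

Section AssociatedGraded.
Variables (p : nat) (pr : prime p) (G : gpresheaf p).
Hypothesis pG : forall n, (p.-group [set: g_obj G n])%g.

Local Notation gm A x := (@g_map p G _ _ A x).
Local Notation Phi_ n k := (PhiN p (g_obj G n) k).

Definition grQ_group n k : {group coset_of (Phi_ n k.+1)} :=
  (PhiN_group p (g_obj G n) k / Phi_ n k.+1)%G.

(** Every vector of the k-th piece is such a class, so identities for [gr_piece_map] reduce to
    identities in [G]. *)
Definition gr_class n k (x : g_obj G n) : 'rV['F_p]_(grdim p (g_obj G n) k) :=
  coordf p (grQ p (g_obj G n) k) (coset (Phi_ n k.+1) x).

Lemma mem_grQ n k x : x \in Phi_ n k -> coset (Phi_ n k.+1) x \in grQ_group n k.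
Proof. exact: mem_quotient. Qed.

Lemma mem_norm_Phi n k x : x \in Phi_ n k -> x \in ('N(Phi_ n k.+1))%g.
Proof. exact: (subsetP (PhiN_norm (pG n) k)). Qed.

Lemma gr_classM n k x y : x \in Phi_ n k -> y \in Phi_ n k ->
  gr_class k (x * y)%g = gr_class k x + gr_class k y.
Proof.
move=> xk yk; rewrite /gr_class morphM ?mem_norm_Phi //.
by apply: (coordfM pr (grQ_abelem (pG n) k : (p.-abelem (grQ_group n k))%g)); apply: mem_grQ.
Qed.

Lemma gr_class_surj n k v : exists2 x, x \in Phi_ n k & gr_class k x = v.
Proof.
have [uQ uv] := uncoordfP pr (grQ_abelem (pG n) k : (p.-abelem (grQ_group n k))%g) v.
case/morphimP: uQ => x nx xk xE; exists x => //.
by rewrite xE in uv.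
Qed.

Lemma g_map_Phi m n (A : 'M['F_p]_(n, m)) k x : x \in Phi_ m k -> gm A x \in Phi_ n k.
Proof.
pose h := Morphism (D := [set: g_obj G m]) (fun x y _ _ => g_mapM A x y).
have hS k' : (h @* Phi_ m k' \subset Phi_ n k')%g.
  elim: k' => [|k' IH]; first exact: subsetT.
  have hk z : z \in Phi_ m k' -> h z \in Phi_ n k'.
    by move=> zk; apply: (subsetP IH); apply: mem_morphim; rewrite ?inE.
  rewrite [Phi_ m k'.+1]/(PhiN _ _ _) /= /PhiP morphim_gen ?subsetT // gen_subG.
  apply/subsetP=> _ /morphimP[z _ zP ->]; apply: mem_gen.
  case/setUP: zP => [/imset2P[a b ak bk ->]|/imsetP[a ak ->]]; apply/setUP; [left|right].
    by apply/imset2P; exists (h a) (h b); rewrite ?hk // morphR ?inE.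
  by apply/imsetP; exists (h a); rewrite ?hk // morphX ?inE.
by move=> xk; apply: (subsetP (hS k)); apply: (mem_morphim h); rewrite ?inE.
Qed.

(** Independence of the representative: [repr] differs from [x] by an element of Phi_(k+1), which
    [gm A] sends into Phi_(k+1). *)
Lemma gr_piece_class m n (A : 'M['F_p]_(n, m)) k x : x \in Phi_ m k ->
  gr_piece_map A (gr_class k x) = gr_class k (gm A x).
Proof.
move=> xk; rewrite /gr_piece_map {1}/gr_class.
have -> := coordfK pr (grQ_abelem (pG m) k : (p.-abelem (grQ_group m k))%g) (mem_grQ xk).
rewrite /gr_class; congr (coordf _ _ _); set r := repr _.
have : r \in coset (Phi_ m k.+1) x by exact: mem_repr_coset.
rewrite val_coset ?mem_norm_Phi // => /rcosetP[h hk ->].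
have hk' := g_map_Phi A hk; rewrite g_mapM morphM ?mem_norm_Phi ?g_map_Phi //.
  by rewrite /= (coset_id hk') mul1g.
exact: (subsetP (PhiN_sub (pG m) k)).
Qed.

Lemma gr_piece_mapD m n (A : 'M['F_p]_(n, m)) k (u v : 'rV['F_p]_(grdim p (g_obj G m) k)) :
  gr_piece_map A (u + v) = gr_piece_map A u + gr_piece_map A v :> 'rV_(grdim p (g_obj G n) k).
Proof.
have [x xk <-] := gr_class_surj u; have [y yk <-] := gr_class_surj v.
rewrite -gr_classM // !gr_piece_class //; last exact: groupM.
by rewrite g_mapM gr_classM ?g_map_Phi.
Qed.

Lemma gr_piece_map0 m n (A : 'M['F_p]_(n, m)) k :
  gr_piece_map A (0 : 'rV['F_p]_(grdim p (g_obj G m) k)) = 0 :> 'rV['F_p]_(grdim p (g_obj G n) k).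
Proof.
apply: (addrI (gr_piece_map A (0 : 'rV['F_p]_(grdim p (g_obj G m) k)))).
by rewrite -gr_piece_mapD !addr0.
Qed.

Lemma gr_piece_mapP m n (A : 'M['F_p]_(n, m)) k c (u v : 'rV['F_p]_(grdim p (g_obj G m) k)) :
  gr_piece_map A (c *: u + v) = c *: gr_piece_map A u + gr_piece_map A v
    :> 'rV_(grdim p (g_obj G n) k).
Proof.
(* Scalars in F_p are multiples of 1, so additivity implies linearity. *)
rewrite gr_piece_mapD; congr (_ + _); rewrite -[c]natr_Zp !scaler_nat.
elim: (nat_of_ord c) => [|j IH]; first by rewrite !mulr0n gr_piece_map0.
by rewrite !mulrS gr_piece_mapD IH.
Qed.

(** The number of blocks varies with n; extension by zero to all k makes components at m and n
    comparable. *)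
Definition gr_component n (v : gr_obj G n) k : 'rV['F_p]_(grdim p (g_obj G n) k) :=
  match @idP (k < grN G n)%N with
  | ReflectT h => submxrow v (Ordinal h)
  | ReflectF _ => 0
  end.

Lemma rV0_eq d (u v : 'rV['F_p]_d) : d = 0%N -> u = v.
Proof. by move=> d0; subst d; rewrite [u]thinmx0 [v]thinmx0. Qed.

Lemma gr_component_lt n (v : gr_obj G n) k (h : (k < grN G n)%N) :
  gr_component v k = submxrow v (Ordinal h).
Proof. exact: reflect_match_true. Qed.

Lemma gr_component_ge n (v : gr_obj G n) k : ~ (k < grN G n)%N -> gr_component v k = 0.
Proof. exact: reflect_match_false. Qed.

Lemma gr_component_map m n (A : 'M['F_p]_(n, m)) v k :
  gr_component (gr_map A v) k = gr_piece_map A (gr_component v k).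
Proof.
have [h|nh] := pselect (k < grN G n)%N; last first.
  (* Beyond [grN G n] the piece has dimension zero. *)
  by apply: rV0_eq; apply: (grdim_trivial pr (pG n)); rewrite leqNgt; apply/negP.
rewrite gr_component_lt /gr_map mxrowK /=.
have [h'|nh'] := pselect (k < grN G m)%N.
  by rewrite (reflect_match_true _ _ _ h') gr_component_lt.
by rewrite reflect_match_false // gr_component_ge // gr_piece_map0.
Qed.

Lemma gr_component_inj n (u v : gr_obj G n) :
  (forall k, gr_component u k = gr_component v k) -> u = v.
Proof.
move=> uv; rewrite -[u]submxrowK -[v]submxrowK; apply/eq_mxrowP => -[k h].
by have := uv k; rewrite !gr_component_lt.
Qed.

Lemma gr_componentP n c (u v : gr_obj G n) k :
  gr_component (c *: u + v) k = c *: gr_component u k + gr_component v k.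
Proof.
have [h|nh] := pselect (k < grN G n)%N; last first.
  by rewrite !gr_component_ge // scaler0 addr0.
by rewrite !gr_component_lt; apply/matrixP=> i j; rewrite !mxE.
Qed.

Lemma gr_map_functor : is_Ffunctor (@gr_map p G).
Proof.
split=> [m n A c u v|n u|l m n A B u]; apply: gr_component_inj => k.
- apply: etrans (gr_component_map A _ k) _.
  apply: etrans (congr1 _ (gr_componentP c u v k)) _.
  apply: etrans (gr_piece_mapP A c _ _) _; symmetry.
  apply: etrans (gr_componentP c (gr_map A u) (gr_map A v) k) _.
  by congr (_ *: _ + _); apply: gr_component_map.
- rewrite gr_component_map; have [x xk <-] := gr_class_surj (gr_component u k).
  by rewrite gr_piece_class // g_map1.
- rewrite !gr_component_map; have [x xk <-] := gr_class_surj (gr_component u k).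
  by rewrite !gr_piece_class ?g_map_Phi // g_mapC.
Qed.

Lemma card_gr_obj n :
  #|{: 'rV['F_p]_(\sum_(k < grN G n) grdim p (g_obj G n) k)}| = #|g_obj G n|.
Proof. by rewrite card_mx card_Fp // mul1n card_grdim. Qed.

Lemma p_finite_growth : p_finite G <-> exists c D, group_growth G c D.
Proof.
split=> [[_ [k [S series]]]|[c [D gr]]].
  have [c [D H]] := series_growth pr gr_map_functor series.
  exists c, D => n; have [t [st tx]] := H n; rewrite -card_gr_obj cardE.
  apply: leq_trans (_ : size (lspan t) <= _)%N.
    by apply: uniq_leq_size (enum_uniq _) _ => x _; apply: tx.
  by rewrite size_lspan // leq_pexp2l ?prime_gt0.
split; first exact: gr_map_functor.
apply: (growth_series gr_map_functor (c := c) (D := D)) => n.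
exists (enum {: 'rV['F_p]_(\sum_(k < grN G n) grdim p (g_obj G n) k)}); split.
  by rewrite -cardE card_gr_obj.
by move=> x; apply: (mem_enum predT).
Qed.

Lemma finite_underlying_growth : finite_underlying G <-> exists c D, group_growth G c D.
Proof.
split=> [[V [f [[Ff [k [S series]]] [i [i_inj _]]]]]|[c [D gr]]]; last first.
  exact: group_growth_finite gr.
have [c [D H]] := series_growth pr Ff series.
exists c, D => n; have [t [st tx]] := H n; rewrite cardE -(size_map (i n)).
apply: leq_trans (_ : size (lspan t) <= _)%N.
  apply: uniq_leq_size => [|x _]; last exact: tx.
  by rewrite (map_inj_uniq (i_inj n)) enum_uniq.
by rewrite size_lspan // leq_pexp2l ?prime_gt0.
Qed.

End AssociatedGraded.

Theorem theorem8p12 (p : nat) (G : gpresheaf p) :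
  prime p ->
  (forall n : nat, (p.-group [set: g_obj G n])%g) ->
  [set: g_obj G 0] = 1%g ->
  (p_finite G <-> finite_underlying G).
Proof.
by move=> pr pG _; rewrite p_finite_growth // finite_underlying_growth.
Qed.
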